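(* Let $\mathcal{H}_{1},\mathcal{H}_{2},\mathcal{H}_{3}$ be Hilbert spaces over the same field, and let $A\in\mathcal{B}(\mathcal{H}_{1},\mathcal{H}_{2})$, $U\in\mathcal{B}(\mathcal{H}_{3},\mathcal{H}_{2})$, and $V\in\mathcal{B}(\mathcal{H}_{3},\mathcal{H}_{1})$. Assume that $\mathcal{R}(A)$ is closed, let $S_{A}=I+V^{\ast}A^{\dagger}U\in\mathcal{B}(\mathcal{H}_{3},\mathcal{H}_{3})$, and assume that $\mathcal{R}(S_{A})$ is closed. Put $E_{S_{A}}=I-S_{A}S_{A}^{\dagger}$ and $F_{S_{A}}=I-S_{A}^{\dagger}S_{A}$. If $\mathcal{R}(U)\subseteq \mathcal{R}(A)$, $\mathcal{R}(V)\subseteq \mathcal{R}(A^{\ast})$, $\mathcal{R}(U^{\ast})\subseteq \mathcal{R}(S_{A})$, and $\mathcal{R}(V^{\ast})\subseteq \mathcal{R}(S_{A}^{\ast})$, then $\mathcal{R}(A+UV^{\ast})$ is closed and $$(A+UV^{\ast})^{\dagger}=\big(I+A^{\dagger}UF_{S_{A}}U^{\ast}(A^{\dagger})^{\ast}\big)^{-1}\big(A^{\dagger}-A^{\dagger}US_{A}^{\dagger}V^{\ast}A^{\dagger}\big)\big(I+(A^{\dagger})^{\ast}VE_{S_{A}}V^{\ast}A^{\dagger}\big)^{-1}.$$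
   Context: $\mathcal{B}(\mathcal{H},\mathcal{K})$ is the set of bounded linear operators from the Hilbert space $\mathcal{H}$ into the Hilbert space $\mathcal{K}$; $I$ is the identity operator on the appropriate space. For $T\in\mathcal{B}(\mathcal{H},\mathcal{K})$, $T^{\ast}$ is the adjoint and $\mathcal{R}(T)$ the range. The Moore--Penrose inverse $T^{\dagger}\in\mathcal{B}(\mathcal{K},\mathcal{H})$, if it exists, is the unique operator $Z\in\mathcal{B}(\mathcal{K},\mathcal{H})$ with $TZT=T$, $ZTZ=Z$, $(TZ)^{\ast}=TZ$, $(ZT)^{\ast}=ZT$; it exists if and only if $\mathcal{R}(T)$ is closed. The two operators that are inverted in the formula are identity plus positive semidefinite bounded operators, hence boundedly invertible. *)

(* Defs.v *)
From HB Require Import structures.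
From mathcomp Require Import all_boot all_order all_algebra.
From mathcomp Require Import sesquilinear.
From mathcomp Require Import boolp classical_sets functions reals topology.
From mathcomp Require Import normedtype.
From mathcomp Require Import complex.

Set Implicit Arguments.
Unset Strict Implicit.
Unset Printing Implicit Defensive.

Import Order.TTheory GRing.Theory Num.Theory.
Import numFieldNormedType.Exports.

Local Open Scope classical_set_scope.
Local Open Scope ring_scope.

(* A Hilbert space is real or complex, so the scalar field is R or R[i]. *)
Variant scalar_kind := RealScalars | ComplexScalars.

Definition scalar_field (R : realType) (k : scalar_kind) : numFieldType :=
  match k with
  | RealScalars => R
  | ComplexScalars => R[i]%C
  end.

Definition scalar_conj (R : realType) (k : scalar_kind) :
    involutive_rmorphism (scalar_field R k) :=
  match k return involutive_rmorphism (scalar_field R k) with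
  | RealScalars => @idfun R
  | ComplexScalars => @Num.conj R[i]%C
  end.

(* The norm of a normed module over K takes its values in K, so the two sides
   of norm_inner are compared in the scalar field. *)
HB.mixin Record isHilbert (R : realType) (k : scalar_kind) H
    & CompleteNormedModule (scalar_field R k) H := {
  inner : {dot H for scalar_conj R k} ;
  norm_inner : forall x : H, `|x| ^+ 2 = inner x x
}.

#[short(type="hilbertType")]
HB.structure Definition Hilbert (R : realType) (k : scalar_kind) :=
  {H of isHilbert R k H & CompleteNormedModule (scalar_field R k) H}.

Notation "''[' x , y ]" := (inner x y) : ring_scope.

HB.mixin Record isBoundedFun (R : realType) (k : scalar_kind)
    (H K : hilbertType R k) (T : H -> K) := {
  bounded_fun_subproof :
    exists2 M : scalar_field R k, 0 <= M & forall x, `|T x| <= M * `|x|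
}.

#[short(type="bounded_operator")]
HB.structure Definition BoundedOperator (R : realType) (k : scalar_kind)
    (H K : hilbertType R k) :=
  {T of isBoundedFun R k H K T & @GRing.Linear _ H K *:%R T}.

Notation "''B' ( H , K )" := (bounded_operator H K)
  (at level 8, format "''B' ( H ,  K )") : type_scope.

Section BoundedOperators.
Variables (R : realType) (k : scalar_kind).
Implicit Types H K L : hilbertType R k.

Lemma bounded_operator_eq H K (S T : 'B(H, K)) : S =1 T -> S = T.
Proof.
case: S T => S [[SB] [SD] [SZ]] [T [[TB] [TD] [TZ]]] /= /funext eqST.
case: _ / eqST in TB TD TZ *.
by rewrite (Prop_irrelevance SB TB) (Prop_irrelevance SD TD)
  (Prop_irrelevance SZ TZ).
Qed.

Lemma operator_bounded H K (T : 'B(H, K)) :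
  exists2 M : scalar_field R k, 0 <= M & forall x, `|T x| <= M * `|x|.
Proof. exact: bounded_fun_subproof. Qed.

HB.instance Definition _ H K := gen_eqMixin 'B(H, K).
HB.instance Definition _ H K := gen_choiceMixin 'B(H, K).

Fact id_op_bounded H :
  exists2 M : scalar_field R k, 0 <= M & forall x : H, `|idfun x| <= M * `|x|.
Proof. by exists 1 => [|x]; rewrite ?ler01 ?mul1r. Qed.

HB.instance Definition _ H := isBoundedFun.Build R k H H idfun (id_op_bounded H).

Definition id_op H : 'B(H, H) := idfun.

Fact comp_op_bounded H K L (S : 'B(K, L)) (T : 'B(H, K)) :
  exists2 M : scalar_field R k, 0 <= M & forall x, `|(S \o T) x| <= M * `|x|.
Proof.
have [M M0 SM] := operator_bounded S.
have [N N0 TN] := operator_bounded T.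
exists (M * N) => [|x]; first exact: mulr_ge0.
by rewrite (le_trans (SM _))// -mulrA ler_wpM2l.
Qed.

HB.instance Definition _ H K L (S : 'B(K, L)) (T : 'B(H, K)) :=
  isBoundedFun.Build R k H L (S \o T) (comp_op_bounded S T).

Definition comp_op H K L (S : 'B(K, L)) (T : 'B(H, K)) : 'B(H, L) := S \o T.

Fact zero_op_bounded H K :
  exists2 M : scalar_field R k, 0 <= M &
    forall x : H, `|(\0 : H -> K) x| <= M * `|x|.
Proof. by exists 0 => // x; rewrite normr0 mul0r. Qed.

HB.instance Definition _ H K :=
  isBoundedFun.Build R k H K \0 (zero_op_bounded H K).

Fact add_op_bounded H K (S T : 'B(H, K)) :
  exists2 M : scalar_field R k, 0 <= M & forall x, `|(S \+ T) x| <= M * `|x|.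
Proof.
have [M M0 SM] := operator_bounded S.
have [N N0 TN] := operator_bounded T.
exists (M + N) => [|x]; first exact: addr_ge0.
by rewrite (le_trans (ler_normD _ _))// mulrDl lerD.
Qed.

HB.instance Definition _ H K (S T : 'B(H, K)) :=
  isBoundedFun.Build R k H K (S \+ T) (add_op_bounded S T).

Fact opp_op_bounded H K (T : 'B(H, K)) :
  exists2 M : scalar_field R k, 0 <= M & forall x, `|(\- T) x| <= M * `|x|.
Proof.
by have [M M0 TM] := operator_bounded T; exists M => // x; rewrite normrN.
Qed.

HB.instance Definition _ H K (T : 'B(H, K)) :=
  isBoundedFun.Build R k H K (\- T) (opp_op_bounded T).

Let zero_op H K : 'B(H, K) := \0.
Let add_op H K (S T : 'B(H, K)) : 'B(H, K) := S \+ T.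
Let opp_op H K (T : 'B(H, K)) : 'B(H, K) := \- T.

Fact add_opA H K : associative (@add_op H K).
Proof. by move=> S T U; apply/bounded_operator_eq => x /=; rewrite addrA. Qed.

Fact add_opC H K : commutative (@add_op H K).
Proof. by move=> S T; apply/bounded_operator_eq => x /=; rewrite addrC. Qed.

Fact add_0op H K : left_id (zero_op H K) (@add_op H K).
Proof. by move=> T; apply/bounded_operator_eq => x /=; rewrite add0r. Qed.

Fact add_opN H K : left_inverse (zero_op H K) (@opp_op H K) (@add_op H K).
Proof. by move=> T; apply/bounded_operator_eq => x /=; rewrite addNr. Qed.

HB.instance Definition _ H K := GRing.isZmodule.Build 'B(H, K)
  (@add_opA H K) (@add_opC H K) (@add_0op H K) (@add_opN H K).

Lemma id_opE H (x : H) : id_op H x = x. Proof. by []. Qed.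

Lemma comp_opE H K L (S : 'B(K, L)) (T : 'B(H, K)) x : comp_op S T x = S (T x).
Proof. by []. Qed.

Lemma zero_opE H K (x : H) : (0 : 'B(H, K)) x = 0. Proof. by []. Qed.

Lemma add_opE H K (S T : 'B(H, K)) x : (S + T) x = S x + T x.
Proof. by []. Qed.

Lemma opp_opE H K (T : 'B(H, K)) x : (- T) x = - T x. Proof. by []. Qed.

End BoundedOperators.

Arguments id_op {R k H}.

Notation "S ** T" := (comp_op S T)
  (at level 40, left associativity) : ring_scope.

Section AdjointInverses.
Variables (R : realType) (k : scalar_kind).
Implicit Types H K : hilbertType R k.

Definition is_adjoint H K (T : 'B(H, K)) (Z : 'B(K, H)) :=
  forall x y, '[T x, y] = '[x, Z y].

(* [xget 0 P] is an element of [P] when there is one and 0 otherwise. Each of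
   the three sets below has at most one element. The set of adjoints is never
   empty; the set of Moore-Penrose inverses is nonempty iff [range T] is
   closed. *)
Definition adj H K (T : 'B(H, K)) : 'B(K, H) :=
  xget 0 [set Z | is_adjoint T Z].

Definition is_mpinv H K (T : 'B(H, K)) (Z : 'B(K, H)) :=
  [/\ T ** Z ** T = T, Z ** T ** Z = Z,
      adj (T ** Z) = T ** Z & adj (Z ** T) = Z ** T].

Definition mpinv H K (T : 'B(H, K)) : 'B(K, H) :=
  xget 0 [set Z | is_mpinv T Z].

Definition is_inv H K (T : 'B(H, K)) (Z : 'B(K, H)) :=
  T ** Z = id_op /\ Z ** T = id_op.

Definition inv_op H K (T : 'B(H, K)) : 'B(K, H) :=
  xget 0 [set Z | is_inv T Z].

End AdjointInverses.

(* Main.v *)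
Require Import Defs.
From HB Require Import structures.
From mathcomp Require Import all_boot all_order all_algebra.
From mathcomp Require Import sesquilinear complex.
From mathcomp Require Import boolp classical_sets functions reals topology.
From mathcomp Require Import normedtype.

Set Implicit Arguments.
Unset Strict Implicit.
Unset Printing Implicit Defensive.

Import Order.TTheory GRing.Theory Num.Theory.
Import numFieldNormedType.Exports.

Local Open Scope classical_set_scope.
Local Open Scope ring_scope.

(** Write X' for the adjoint of X, B for the Moore-Penrose inverse of A, S for
    I + V' B U and G for the Moore-Penrose inverse of S.  The four range
    inclusions say that certain projections fix certain operators: A B U = U,
    V' B A = V', U S G = U and G S V' = V'.  The last two force S to be
    invertible.  Indeed, for E = I - S G, U E = 0 gives S E = E, so the range
    of E lies in the range of S, where the projection E vanishes; hence
    E = E E = 0.  The same argument on the other side gives F = I - G S = 0.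
    The two operators to be inverted in the formula are therefore identities,
    and with N = B - B U G V' B a direct computation using V' B U = S - I gives
    (A + U V') N = A B and N (A + U V') = B A.  These products are
    self-adjoint and N satisfies the Penrose equations.  Any operator with an
    inner inverse has closed range, as the kernel of a continuous map.

    The analytic content is the existence of B and G, that is
    [mpinv_exists]: an operator A with closed range has a Moore-Penrose
    inverse.  If P is the orthogonal projection onto the range of A, the
    operator T = A A' + (I - P) is self-adjoint, commutes with P and agrees
    with A A' on the range of A, so A' T^-1 is the wanted inverse as soon as T
    is boundedly invertible.  Coercive operators are invertible
    ([coercive_invertible]), and T is coercive when A' is bounded below on the
    range of A.  This last fact ([adjoint_bounded_below]) takes the place of the
    open mapping theorem: the vectors w in the range of A with |A' w| <= 1 form
    a weakly bounded set, since any y may be replaced by its projection A x and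
    |<w, A x>| = |<A' w, x>| <= |x|; by the uniform boundedness principle
    ([weakly_bounded]) that set is bounded in norm.

    Norms take their values in the scalar field, which is R or R[i].  The
    proofs are uniform in the two cases: on the side of the scalars they
    rest on the archimedean property and the existence of infima for nonnegative
    elements. *)

(** * Nonnegative elements of the scalar field *)

Section Scalars.
Variables (R : realType) (k : scalar_kind).
Local Notation K := (scalar_field R k).

Lemma scalar_conjE (z : K) : z * scalar_conj R k z = `|z| ^+ 2.
Proof.
case: k z => /= z; first by rewrite -expr2 real_normK ?num_real.
by rewrite normCK.
Qed.

(** The order of R[i] is partial, but its nonnegative elements are real; so
    order-theoretic facts about nonnegative scalars transfer from R. *)
Lemma scalar_of_real : exists f : {rmorphism R -> K},
  {mono f : x y / x <= y} /\ forall z : K, 0 <= z -> exists x, z = f x.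
Proof.
case: k => /=; first by exists idfun; split=> // z _; exists z.
exists (real_complex R); split.
  by move=> x y; rewrite lecR.
by move=> z /ger0_real /complex_realP.
Qed.

Lemma scalar_archimedean (z : K) : 0 <= z -> exists n, z < n%:R.
Proof.
have [f [fle fge0]] := scalar_of_real.
move=> /fge0[x ->]; exists (Num.truncn x).+1.
by rewrite -(rmorph_nat f) (leW_mono fle) truncnS_gt.
Qed.

Lemma scalar_inf (D : set K) : D !=set0 -> (forall z, D z -> 0 <= z) ->
  exists2 d, (forall z, D z -> d <= z) &
             forall e, 0 < e -> exists2 z, D z & z < d + e.
Proof.
have [f [fle fge0]] := scalar_of_real.
move=> [z0 Dz0] D0; pose S := [set x | D (f x)].
have [x0 z0E] := fge0 _ (D0 _ Dz0).
have SI : has_inf S.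
  split; first by exists x0; rewrite /S /= -z0E.
  by exists 0 => x /D0; rewrite -(rmorph0 f) fle.
exists (f (inf S)) => [z Dz|e e0].
  have [x zE] := fge0 _ (D0 _ Dz); rewrite zE fle.
  by apply: ge_inf; [exact: SI.2 | rewrite /S /= -zE].
have [r eE] := fge0 _ (ltW e0).
have r0 : 0 < r by rewrite -(leW_mono fle) rmorph0 -eE.
have [x Sx xlt] := inf_adherent r0 SI.
by exists (f x) => //; rewrite eE -rmorphD (leW_mono fle).
Qed.

(** Comparability must be assumed, as the order of the scalars is partial. *)
Lemma real_ler_addgt0 (x y : K) : x \is Num.real -> y \is Num.real ->
  (forall e, 0 < e -> x <= y + e) -> x <= y.
Proof.
move=> xr yr xy; have [//|yx] := real_leP xr yr.
have e0 : 0 < (x - y) / 2 by rewrite divr_gt0 ?subr_gt0.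
have := xy _ e0; rewrite -lerBlDl ler_pdivlMr// mulr_natr mulr2n.
by rewrite gerDl lt_geF ?subr_gt0.
Qed.

End Scalars.

(** * Approximation and completeness in Hilbert spaces *)

Section Metric.
Variables (R : realType) (k : scalar_kind).
Local Notation K := (scalar_field R k).
Implicit Type H : hilbertType R k.

(** Closedness in epsilon form; all closedness hypotheses are used, and all
    closedness goals proved, through this form. *)
Lemma closed_approxP H (M : set H) :
  closed M <-> forall x, (forall d, 0 < d -> exists2 m, M m & `|x - m| <= d) ->
    M x.
Proof.
split=> [clM x xM | clM x].
  apply: clM => B /nbhs_normP[e /= e0 eB].
  have e20 : 0 < e / 2 by rewrite divr_gt0.
  have [m Mm xm] := xM _ e20; exists m; split=> //; apply: eB.
  by rewrite /ball_/= (le_lt_trans xm)// gtr_pMr// invf_lt1// ltr1n.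
move=> clx; apply: clM => d d0.
have [|m [Mm /= xm]] := clx (ball x d); first exact: nbhsx_ballx.
by exists m => //; move: xm; rewrite -ball_normE => /ltW.
Qed.

(** Completeness with an explicit modulus: keeping the error bound [e] on the
    limit is what the projection theorem, the closedness of the range of a
    coercive operator and the gliding hump all need. *)
Lemma complete_modulus H (u : nat -> H) (e : nat -> K) :
    (forall n, 0 <= e n) ->
    (forall m n, (n <= m)%N -> `|u m - u n| <= e n) ->
    (forall d, 0 < d -> exists n, e n < d) ->
  exists l, forall n, `|l - u n| <= e n.
Proof.
move=> e0 ue eto0.
have /cauchy_cvg/cvg_ex[l ul] : cauchy (u @ \oo).
  apply: cauchy_exP => d d0; have [n en] := eto0 _ d0.
  exists (u n); exists n => // m /= nm.
  by rewrite -ball_normE /= distrC (le_lt_trans (ue _ _ nm)).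
exists l => n; apply: real_ler_addgt0; rewrite ?normr_real ?ger0_real// => d d0.
have /cvgrPdist_lt/(_ _ d0)[N _ lN] := ul.
have := lN (maxn N n) (leq_maxl _ _) => /= lNn.
rewrite -(subrK (u (maxn N n)) l) -addrA addrC.
by rewrite (le_trans (ler_normD _ _))// lerD ?ue ?leq_maxr// ltW.
Qed.

Lemma invSn_small (d : K) : 0 < d -> exists n, n.+1%:R^-1 < d.
Proof.
move=> d0; have [|n dn] := @scalar_archimedean _ _ d^-1.
  by rewrite invr_ge0 ltW.
exists n; rewrite -[d]invrK ltf_pV2 ?posrE ?invr_gt0//.
by rewrite (lt_le_trans dn)// ler_nat.
Qed.

End Metric.

(** * Inner products *)

Section Inner.
Variables (R : realType) (k : scalar_kind).
Local Notation K := (scalar_field R k).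
Variable H : hilbertType R k.
Implicit Types x y z : H.

Lemma innerC x y : '[x, y] = scalar_conj R k '[y, x].
Proof. by rewrite hermitian_subproof expr0 mul1r. Qed.

Lemma inner_norm x : '[x, x] = `|x| ^+ 2. Proof. by rewrite norm_inner. Qed.

Lemma innerDl x y z : '[x + y, z] = '[x, z] + '[y, z].
Proof. exact: linearDl. Qed.

Lemma innerDr x y z : '[x, y + z] = '[x, y] + '[x, z].
Proof. exact: linearDr. Qed.

Lemma innerBl x y z : '[x - y, z] = '[x, z] - '[y, z].
Proof. exact: linearBl. Qed.

Lemma innerBr x y z : '[x, y - z] = '[x, y] - '[x, z].
Proof. exact: linearBr. Qed.

Lemma inner0l x : '[0, x] = 0. Proof. exact: linear0l. Qed.

Lemma inner0r x : '[x, 0] = 0. Proof. exact: linear0r. Qed.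

Lemma innerZl (a : K) x y : '[a *: x, y] = a * '[x, y].
Proof. exact: linearZl_LR. Qed.

Lemma innerZr (a : K) x y : '[x, a *: y] = scalar_conj R k a * '[x, y].
Proof. exact: linearZr_LR. Qed.

Lemma norm_innerC x y : `|'[x, y]| = `|'[y, x]|.
Proof.
have conjN (z : K) : `|scalar_conj R k z| = `|z|.
  apply/eqP; rewrite -(@eqrXn2 _ 2)// -!scalar_conjE.
  by rewrite (rmorphK (scalar_conj R k)) mulrC.
by rewrite innerC conjN.
Qed.

Lemma inner_eq0C x y : '[x, y] = 0 -> '[y, x] = 0.
Proof. by move=> xy; rewrite innerC xy rmorph0. Qed.

Lemma inner_inj x y : (forall z, '[x, z] = '[y, z]) -> x = y.
Proof.
move=> xy; apply/eqP; rewrite -subr_eq0 -normr_eq0 -sqrf_eq0 -inner_norm.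
by rewrite innerBl xy subrr.
Qed.

Lemma pythagoras x y : '[x, y] = 0 -> `|x + y| ^+ 2 = `|x| ^+ 2 + `|y| ^+ 2.
Proof.
move=> xy; rewrite -!inner_norm innerDl !innerDr xy (inner_eq0C xy).
by rewrite addr0 add0r.
Qed.

(** Removing from [x] its component along [y] is an orthogonal decomposition,
    so this is Pythagoras; it yields both Cauchy-Schwarz and the estimate
    for almost closest points. *)
Lemma norm_sub_proj x y : y != 0 ->
  `|x - ('[x, y] / `|y| ^+ 2) *: y| ^+ 2 =
    `|x| ^+ 2 - `|'[x, y]| ^+ 2 / `|y| ^+ 2.
Proof.
move=> y0; set t := _ / _.
have n0 : `|y| ^+ 2 != 0 by rewrite sqrf_eq0 normr_eq0.
have o : '[x - t *: y, t *: y] = 0.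
  by rewrite innerZr innerBl innerZl inner_norm divfK ?subrr ?mulr0.
have := pythagoras o; rewrite subrK normrZ => ->.
rewrite /t normrM normfV normrX normr_id.
rewrite exprMn expr_div_n; move: (`|y| ^+ 2) n0 => c c0.
by rewrite [c ^+ 2]expr2 [(c * c)^-1]invfM mulrA divfK// addrK.
Qed.

Lemma cauchy_schwarz x y : `|'[x, y]| <= `|x| * `|y|.
Proof.
have [->|y0] := eqVneq y 0; first by rewrite inner0r !normr0 mulr0.
rewrite -(@ler_pXn2r _ 2)// ?nnegrE ?mulr_ge0// exprMn.
rewrite -ler_pdivrMr ?exprn_gt0 ?normr_gt0// -subr_ge0 -norm_sub_proj//.
exact: exprn_ge0.
Qed.

End Inner.

(** * Orthogonal projection and the Riesz theorem *)

Section Projection.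
Variables (R : realType) (k : scalar_kind).
Local Notation K := (scalar_field R k).
Variable H : hilbertType R k.
Implicit Types (x y z : H) (M : set H).

Lemma eq0_le_invSn (a c : K) : 0 <= c ->
  (forall n, `|a| <= c * n.+1%:R^-1) -> a = 0.
Proof.
move=> c0 ac; apply/eqP; rewrite -normr_le0.
apply: real_ler_addgt0; rewrite ?normr_real ?real0// => e e0; rewrite add0r.
have c1 : 0 < c + 1 by rewrite ltr_wpDl.
have [|n ne] := @invSn_small _ _ (e / (c + 1)); first by rewrite divr_gt0.
apply: (le_trans (ac n)); rewrite -[e](@divfK _ (c + 1)) ?gt_eqF//.
by rewrite mulrC ler_pM ?invr_ge0 ?ler0n// ?lerDl ?ler01// ltW.
Qed.

Definition is_subspace M := M 0 /\ forall (a : K) x y, M x -> M y -> M (a *: x + y).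

Lemma subspaceB M x y : is_subspace M -> M x -> M y -> M (x - y).
Proof.
by move=> [_ Ma] Mx My; rewrite addrC -scaleN1r; exact: Ma.
Qed.

(** Take [m] in [M] whose squared distance to [x] exceeds the infimum [d] by
    less than [e ^+ 2].  Moving [m] along [v] to the best point lowers the
    squared distance by the square of the inner product over that of the norm
    of [v], and the result is still at least [d]. *)
Lemma nearly_orthogonal M x (e : K) : is_subspace M -> 0 < e ->
  exists2 m, M m & forall v, M v -> `|'[x - m, v]| <= e * `|v|.
Proof.
move=> [M0 Ma] e0.
pose D := [set z | exists2 m, M m & z = `|x - m| ^+ 2].
have [||d dle dlt] := @scalar_inf _ _ D.
- by exists (`|x - 0| ^+ 2), 0.
- by move=> _ [m _ ->]; exact: exprn_ge0.
have [_ [m Mm ->] mlt] := dlt (e ^+ 2) (exprn_gt0 _ e0).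
exists m => // v Mv; have [->|v0] := eqVneq v 0.
  by rewrite inner0r !normr0 mulr0.
have nv0 : 0 < `|v| ^+ 2 by rewrite exprn_gt0 ?normr_gt0.
rewrite -(@ler_pXn2r _ 2)// ?nnegrE ?mulr_ge0// ?(ltW e0)// exprMn.
rewrite -ler_pdivrMr//.
have : d <= `|(x - m) - ('[x - m, v] / `|v| ^+ 2) *: v| ^+ 2.
  by apply: dle; exists (('[x - m, v] / `|v| ^+ 2) *: v + m);
    [exact: Ma | rewrite opprD addrA addrAC].
rewrite norm_sub_proj// lerBrDr => /le_lt_trans/(_ mlt)/ltW.
by rewrite lerD2l.
Qed.

(** Nearly orthogonal points with errors [1 / n.+1] form a Cauchy sequence:
    the difference of two of them lies in [M], hence is nearly orthogonal to
    itself.  Their limit is the orthogonal projection of [x]. *)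
Lemma orthogonal_decomposition M x : closed M -> is_subspace M ->
  exists2 m, M m & forall v, M v -> '[x - m, v] = 0.
Proof.
move=> clM sM.
have e0 n : 0 < n.+1%:R^-1 :> K by rewrite invr_gt0.
have /choice[m mP] : forall n : nat, exists m, M m /\
    forall v, M v -> `|'[x - m, v]| <= n.+1%:R^-1 * `|v|.
  by move=> n; have [m] := nearly_orthogonal x sM (e0 n); exists m.
have m_near p q : `|m p - m q| <= p.+1%:R^-1 + q.+1%:R^-1.
  have [->|v0] := eqVneq (m p) (m q).
    by rewrite subrr normr0 addr_ge0// ltW.
  have Mv := subspaceB sM (mP p).1 (mP q).1.
  have nv0 : 0 < `|m p - m q| by rewrite normr_gt0 subr_eq0.
  rewrite -(ler_pM2r nv0) -expr2 -[leLHS]ger0_norm ?exprn_ge0//.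
  rewrite -inner_norm.
  have -> : '[m p - m q, m p - m q] =
     '[x - m q, m p - m q] - '[x - m p, m p - m q].
    by rewrite -innerBl; congr '[_, _]; rewrite opprB [RHS]addrC addrA subrK.
  rewrite mulrDl [leRHS]addrC (le_trans (ler_normB _ _))// lerD//.
    exact: (mP q).2.
  exact: (mP p).2.
have e_small (d : K) : 0 < d -> exists n, 2 * n.+1%:R^-1 < d.
  move=> d0; have [|n nd] := @invSn_small _ _ (d / 2); first by rewrite divr_gt0.
  by exists n; rewrite mulrC -ltr_pdivlMr.
have [||//|l lm] := @complete_modulus _ _ _ m (fun n => 2 * n.+1%:R^-1).
- by move=> n; rewrite mulr_ge0// ltW.
- move=> p q qp; apply: (le_trans (m_near p q)).
  by rewrite mulr_natl mulr2n lerD2r lef_pV2 ?posrE// ler_nat.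
exists l.
  move/closed_approxP : clM; apply => d d0; have [n nd] := e_small d d0.
  by exists (m n); [exact: (mP n).1 | rewrite (le_trans (lm n))// ltW].
move=> v Mv; apply: (@eq0_le_invSn _ (3 * `|v|)) => [|n]; first exact: mulr_ge0.
have -> : '[x - l, v] = '[x - m n, v] - '[l - m n, v].
  by rewrite -innerBl opprB addrA subrK.
rewrite (le_trans (ler_normB _ _))//.
have -> : 3 * `|v| * n.+1%:R^-1 = n.+1%:R^-1 * `|v| + 2 * n.+1%:R^-1 * `|v|.
  move: (n.+1%:R^-1) => c; rewrite mulrAC -mulrDl -[c in c + _]mul1r -mulrDl.
  by rewrite -(natrD _ 1 2).
rewrite lerD ?(mP n).2//.
by rewrite (le_trans (cauchy_schwarz _ _))// ler_wpM2r.
Qed.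

(** The kernel of a nonzero bounded functional [f] is closed and proper, so some
    nonzero [u] is orthogonal to it; for every [z] the vector
    [f u *: z - f z *: u] lies in the kernel, and orthogonality to [u]
    computes [f z]. *)
Lemma riesz_representation (f : H -> K) : scalar f ->
  (exists2 C, 0 <= C & forall x, `|f x| <= C * `|x|) ->
  exists y, forall x, f x = '[x, y].
Proof.
move=> lf [C C0 fC].
have f0 : f 0 = 0.
  by apply/eqP; rewrite -normr_le0 (le_trans (fC 0))// normr0 mulr0.
have fB x z : f (x - z) = f x - f z.
  by rewrite addrC -scaleN1r lf /= mulN1r addrC.
have fZ a x : f (a *: x) = a * f x by rewrite -[a *: x]addr0 lf f0 addr0.
pose M := [set x | f x = 0].
have sM : is_subspace M.
  by split=> // a x y fx fy; rewrite /M /= lf fx fy mulr0 addr0.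
have clM : closed M.
  apply/closed_approxP => x xM; apply: (eq0_le_invSn C0) => n.
  have [|m Mm xm] := xM n.+1%:R^-1; first by rewrite invr_gt0.
  by rewrite -[f x]subr0 -Mm -fB (le_trans (fC _))// ler_wpM2l.
have [fz|/existsNP[x /eqP fx]] := pselect (forall x, f x = 0).
  by exists 0 => x; rewrite inner0r fz.
have [m Mm xm] := orthogonal_decomposition x clM sM.
pose u := x - m.
have fu : f u != 0 by rewrite /u fB Mm subr0.
have uu : '[u, u] != 0.
  rewrite inner_norm sqrf_eq0 normr_eq0; apply: contraNneq fu => ->.
  by rewrite f0.
exists (scalar_conj R k (f u / '[u, u]) *: u) => z.
rewrite innerZr (rmorphK (scalar_conj R k)).
have Mw : M (f u *: z - f z *: u).
  by rewrite /M /= fB !fZ mulrC subrr.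
have := inner_eq0C (xm _ Mw); rewrite innerBl !innerZl => /subr0_eq fuz.
by rewrite mulrAC fuz mulfK.
Qed.

End Projection.

(** * Adjoints and the algebra of operators *)

Section Operators.
Variables (R : realType) (k : scalar_kind).
Local Notation K := (scalar_field R k).
Implicit Types H L : hilbertType R k.

Lemma inner_injr H (x y : H) : (forall z, '[z, x] = '[z, y]) -> x = y.
Proof. by move=> xy; apply: inner_inj => z; rewrite innerC xy -innerC. Qed.

Lemma bounded_operator_of H L (f : H -> L) : linear f ->
  (exists2 C : K, 0 <= C & forall x, `|f x| <= C * `|x|) ->
  exists T : 'B(H, L), forall x, T x = f x.
Proof.
move=> lf bf.
pose fl := GRing.isLinear.Build _ _ _ _ f lf.
pose fb := isBoundedFun.Build R k H L f bf.
pose T : 'B(H, L) := HB.pack f fl fb.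
by exists T.
Qed.

Lemma operatorB H L (T : 'B(H, L)) x y : T (x - y) = T x - T y.
Proof. exact: linearB. Qed.

Lemma operatorP H L (T : 'B(H, L)) (a : K) x y :
  T (a *: x + y) = a *: T x + T y.
Proof. exact: linearP. Qed.

(** Riesz representation of [x |-> '[T x, y]] for each [y]; linearity and
    boundedness of the resulting map follow from uniqueness and from
    [|f y|^2 = '[T (f y), y]]. *)
Lemma operator_is_adjoint H L (T : 'B(H, L)) : exists Z, is_adjoint T Z.
Proof.
have [C C0 TC] := operator_bounded T.
have /choice[f fP] : forall y, exists z, forall x, '[T x, y] = '[x, z].
  move=> y; apply: riesz_representation.
    by move=> a x z /=; rewrite linearP innerDl innerZl.
  exists (C * `|y|) => [|x]; first exact: mulr_ge0.
  by rewrite (le_trans (cauchy_schwarz _ _))// mulrAC ler_wpM2r.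
have [||Z ZE] := @bounded_operator_of _ _ f.
- move=> a y z; apply: inner_injr => x.
  by rewrite innerDr innerZr -!fP innerDr innerZr.
- exists C => // y; have [->|fy0] := eqVneq (f y) 0.
    by rewrite normr0 mulr_ge0.
  have nfy0 : 0 < `|f y| by rewrite normr_gt0.
  rewrite -(ler_pM2r nfy0) -expr2 -[leLHS]ger0_norm ?exprn_ge0//.
  rewrite -inner_norm -fP (le_trans (cauchy_schwarz _ _))// mulrAC.
  by rewrite ler_wpM2r.
by exists Z => x y; rewrite ZE fP.
Qed.

Lemma adjP H L (T : 'B(H, L)) x y : '[T x, y] = '[x, adj T y].
Proof.
have [Z ZT] := operator_is_adjoint T.
by move: x y; exact: (@xgetPex _ 0 [set Z | is_adjoint T Z] (ex_intro _ Z ZT)).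
Qed.

Lemma adj_unique H L (T : 'B(H, L)) Z : is_adjoint T Z -> adj T = Z.
Proof.
move=> TZ; apply: bounded_operator_eq => y; apply: inner_injr => x.
by rewrite -adjP TZ.
Qed.

Lemma adjPl H L (T : 'B(H, L)) x y : '[adj T x, y] = '[x, T y].
Proof. by rewrite innerC -adjP -innerC. Qed.

Lemma adjK H L (T : 'B(H, L)) : adj (adj T) = T.
Proof. by apply: adj_unique => x y; exact: adjPl. Qed.

Lemma adj_id H : adj (id_op : 'B(H, H)) = id_op.
Proof. by apply: adj_unique. Qed.

Lemma adj_comp H L N (S : 'B(L, N)) (T : 'B(H, L)) :
  adj (S ** T) = adj T ** adj S.
Proof. by apply: adj_unique => x y; rewrite /= !adjP. Qed.

Lemma adjD H L (S T : 'B(H, L)) : adj (S + T) = adj S + adj T.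
Proof.
by apply: adj_unique => x y; rewrite !add_opE innerDl innerDr !adjP.
Qed.

Lemma adjN H L (T : 'B(H, L)) : adj (- T) = - adj T.
Proof.
apply: adj_unique => x y.
by rewrite !opp_opE -[- T x]sub0r innerBl inner0l sub0r adjP -[- adj T y]sub0r
  innerBr inner0r sub0r.
Qed.

Lemma adjB H L (S T : 'B(H, L)) : adj (S - T) = adj S - adj T.
Proof. by rewrite adjD adjN. Qed.

Section Composition.
Variables H L N P : hilbertType R k.

Lemma comp_opA (S : 'B(N, P)) (T : 'B(L, N)) (W : 'B(H, L)) :
  S ** (T ** W) = S ** T ** W.
Proof. exact: bounded_operator_eq. Qed.

Lemma comp_idop (T : 'B(H, L)) : id_op ** T = T.
Proof. exact: bounded_operator_eq. Qed.

Lemma comp_opid (T : 'B(H, L)) : T ** id_op = T.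
Proof. exact: bounded_operator_eq. Qed.

Lemma comp_0op (T : 'B(H, L)) : (0 : 'B(L, N)) ** T = 0.
Proof. exact: bounded_operator_eq. Qed.

Lemma comp_op0 (T : 'B(L, N)) : T ** (0 : 'B(H, L)) = 0.
Proof. by apply: bounded_operator_eq => x; rewrite comp_opE linear0. Qed.

Lemma comp_opDl (S T : 'B(L, N)) (W : 'B(H, L)) :
  (S + T) ** W = S ** W + T ** W.
Proof. exact: bounded_operator_eq. Qed.

Lemma comp_opBl (S T : 'B(L, N)) (W : 'B(H, L)) :
  (S - T) ** W = S ** W - T ** W.
Proof. exact: bounded_operator_eq. Qed.

Lemma comp_opDr (W : 'B(L, N)) (S T : 'B(H, L)) :
  W ** (S + T) = W ** S + W ** T.
Proof.
by apply: bounded_operator_eq => x; rewrite comp_opE !add_opE linearD.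
Qed.

Lemma comp_opBr (W : 'B(L, N)) (S T : 'B(H, L)) :
  W ** (S - T) = W ** S - W ** T.
Proof.
by apply: bounded_operator_eq => x; rewrite comp_opE !add_opE !opp_opE linearB.
Qed.

End Composition.

Lemma range_subspace H L (T : 'B(H, L)) : is_subspace (range T).
Proof.
split; first by exists 0; rewrite ?linear0.
by move=> a _ _ [x _ <-] [y _ <-]; exists (a *: x + y); rewrite ?linearP.
Qed.

(** Range inclusions are used only as such equations, which can be composed
    and adjoined. *)
Lemma range_sub_fixed H L N (S : 'B(L, N)) (Q : 'B(N, N)) (T : 'B(H, N)) :
  Q ** S = S -> range T `<=` range S -> Q ** T = T.
Proof.
move=> QS TS; apply: bounded_operator_eq => x; have [y _ Sy] : range S (T x).
  by apply: TS; exists x.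
by rewrite comp_opE -Sy -[in RHS]QS.
Qed.

End Operators.

(** * Coercive operators and uniform boundedness *)

Section Invertibility.
Variables (R : realType) (k : scalar_kind).
Local Notation K := (scalar_field R k).
Implicit Types H L : hilbertType R k.

(** Lax-Milgram: coercivity bounds [T] below, so [T] is injective with closed
    range; and a vector orthogonal to the range is orthogonal to its own image,
    hence zero. *)
Lemma coercive_invertible H (T : 'B(H, H)) (C : K) : 0 <= C ->
  (forall x, `|x| ^+ 2 <= C * `|'[T x, x]|) -> exists Z, is_inv T Z.
Proof.
move=> C0 TC.
have below x : `|x| <= C * `|T x|.
  have [->|x0] := eqVneq x 0; first by rewrite normr0 mulr_ge0.
  have nx0 : 0 < `|x| by rewrite normr_gt0.
  rewrite -(ler_pM2r nx0) -expr2 (le_trans (TC x))// -mulrA ler_wpM2l//.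
  exact: cauchy_schwarz.
have Tinj x y : T x = T y -> x = y.
  move=> Txy; apply/eqP; rewrite -subr_eq0 -normr_le0.
  by rewrite (le_trans (below _))// operatorB Txy subrr normr0 mulr0.
have [N N0 TN] := operator_bounded T.
have clT : closed (range T).
  apply/closed_approxP => y yT.
  have /choice[x xP] : forall n : nat, exists x, `|y - T x| <= n.+1%:R^-1.
    move=> n; have [|_ [x _ <-] yx] := yT n.+1%:R^-1; first by rewrite invr_gt0.
    by exists x.
  have [||d d0|l lx] := @complete_modulus _ _ _ x (fun n => C * 2 * n.+1%:R^-1).
  - by move=> n; rewrite !mulr_ge0 ?invr_ge0.
  - move=> m n nm; rewrite (le_trans (below _))// -mulrA ler_wpM2l// operatorB.
    have -> : T (x m) - T (x n) = (y - T (x n)) - (y - T (x m)).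
      by rewrite opprB [RHS]addrC addrA subrK.
    rewrite (le_trans (ler_normB _ _))// mulr_natl mulr2n lerD//.
    by rewrite (le_trans (xP m))// lef_pV2 ?posrE// ler_nat.
  - have c0 : 0 < C * 2 + 1 by rewrite ltr_wpDl// mulr_ge0.
    have [|n nd] := @invSn_small _ _ (d / (C * 2 + 1)).
      by rewrite divr_gt0.
    exists n; rewrite ltr_pdivlMr// in nd; rewrite (le_lt_trans _ nd)//.
    by rewrite mulrC ler_wpM2l ?invr_ge0// lerDl.
  exists l => //; apply/eqP; rewrite eq_sym -subr_eq0 -normr_eq0; apply/eqP.
  apply: (@eq0_le_invSn _ _ _ (1 + N * (C * 2))) => [|n].
    by rewrite addr_ge0// !mulr_ge0.
  have -> : y - T l = (y - T (x n)) - T (l - x n).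
    by rewrite operatorB opprB addrA subrK.
  rewrite normr_id mulrDl mul1r (le_trans (ler_normB _ _))// lerD//.
  by rewrite (le_trans (TN _))// -mulrA ler_wpM2l.
have Tsurj y : range T y.
  have [_ [x _ <-] xT] := orthogonal_decomposition y clT (range_subspace T).
  exists x => //; apply/esym/eqP.
  rewrite -subr_eq0 -normr_eq0 -sqrf_eq0 eq_le exprn_ge0// andbT.
  by rewrite (le_trans (TC _))// norm_innerC xT ?normr0 ?mulr0.
have /choice[g Tg] : forall y, exists x, T x = y.
  by move=> y; have [x _ <-] := Tsurj y; exists x.
have [||Z Zg] := @bounded_operator_of _ _ _ _ g.
- by move=> a x y; apply: Tinj; rewrite operatorP !Tg.
- by exists C => // y; rewrite -[in leRHS](Tg y).
exists Z; split; apply: bounded_operator_eq => x; rewrite comp_opE Zg ?Tg//.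
by apply: Tinj; rewrite Tg.
Qed.

(** One step of the gliding hump.  With [v] the multiple of [w] of norm [c], one
    of [y + v] and [y - v] works, since their inner products with [w] differ by
    twice that of [v], whose absolute value is [c * |w|]. *)
Lemma norming_perturbation H (w y : H) (c : K) : w != 0 -> 0 < c ->
  exists y', `|y' - y| <= c /\ c * `|w| <= `|'[w, y']|.
Proof.
move=> w0 c0; have nw0 : `|w| != 0 by rewrite normr_eq0.
pose v := (c / `|w|) *: w.
have nv : `|v| = c.
  by rewrite normrZ normrM normfV normr_id gtr0_norm// divfK.
have wv : `|'[w, v]| = c * `|w|.
  rewrite norm_innerC innerZl inner_norm expr2 mulrA divfK//.
  by rewrite ger0_norm// mulr_ge0// ltW.
have cw_real : c * `|w| \is Num.real by rewrite ger0_real// mulr_ge0// ltW.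
have [le|lt] := real_leP cw_real (normr_real '[w, y + v]).
  by exists (y + v); rewrite addrAC subrr add0r nv.
exists (y - v); rewrite addrAC subrr add0r normrN nv; split=> //.
have -> : c * `|w| = `|'[w, y + v] - '[w, y - v]| - c * `|w|.
  rewrite -innerBr opprB addrCA [y + v]addrC addrK innerDr -mulr2n normrMn wv mulr2n.
  by rewrite addrK.
rewrite lerBlDr (le_trans (ler_normB _ _))// addrC lerD2l ltW//.
Qed.

(** Uniform boundedness by a gliding hump.  If [W] is unbounded, choose [w n] in
    it with norm above [2 n 3^n] and perturb successively by vectors of norm
    [3^-n] so that the inner product of [w n] with the (n+1)st vector has
    absolute value at least [3^-n |w n|].  All later perturbations
    together have norm at most [3^-n / 2], so the limit still has inner product
    of absolute value above [n] with [w n]. *)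
Lemma weakly_bounded H (W : set H) :
  (forall y, exists C : K, forall w, W w -> `|'[w, y]| <= C) ->
  exists2 C : K, 0 <= C & forall w, W w -> `|w| <= C.
Proof.
move=> Wy; apply: contrapT => Wunb.
have /choice[w wP] : forall n : nat, exists w, W w /\ n%:R * 2 * 3 ^+ n < `|w|.
  move=> n; apply: contrapT => nw; apply: Wunb.
  exists (n%:R * 2 * 3 ^+ n); first by rewrite !mulr_ge0// exprn_ge0.
  move=> w Ww; have n_real : n%:R * 2 * 3 ^+ n \is @Num.real K.
    by rewrite ger0_real// !mulr_ge0// exprn_ge0.
  have [//|lt] := real_leP (normr_real w) n_real.
  by case: nw; exists w.
pose c n : K := (3 ^+ n)^-1.
have c0 n : 0 < c n by rewrite invr_gt0 exprn_gt0.
have cS n : c n = 3 * c n.+1.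
  by rewrite /c exprS invfM mulrA divff ?mul1r// pnatr_eq0.
have w0 n : w n != 0.
  rewrite -normr_gt0 (le_lt_trans _ (wP n).2)//.
  by rewrite !mulr_ge0// exprn_ge0.
have /choice[step stepP] : forall ny : nat * H, exists y',
    `|y' - ny.2| <= c ny.1 /\ c ny.1 * `|w ny.1| <= `|'[w ny.1, y']|.
  by move=> [n y]; exact: norming_perturbation.
pose u := fix u n := if n is m.+1 then step (m, u m) else 0.
have uS n : `|u n.+1 - u n| <= c n by exact: (stepP (n, u n)).1.
have wu n : c n * `|w n| <= `|'[w n, u n.+1]| by exact: (stepP (n, u n)).2.
(* [e n] is the sum of the [c m] for [n <= m]. *)
pose e n := c n + c n / 2.
have e0 n : 0 <= e n by rewrite addr_ge0 ?divr_ge0// ltW.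
have eS n : e n = c n + e n.+1.
  rewrite /e; congr (_ + _); rewrite {}cS; move: (c n.+1) => z.
  rewrite (natrD _ 2 1) mulrDl mul1r mulrDl; congr (_ + _).
  by rewrite mulrAC divff ?mul1r// pnatr_eq0.
have u_cauchy m n : (n <= m)%N -> `|u m - u n| <= e n - e m.
  elim: m => [|m IH]; first by rewrite leqn0 => /eqP->; rewrite !subrr normr0.
  rewrite leq_eqVlt => /predU1P[->|/IH nm]; first by rewrite !subrr normr0.
  rewrite -(subrKA (u m)) (le_trans (ler_normD _ _))//.
  by rewrite [leLHS]addrC -[leRHS](subrKA (e m)) lerD// [e m]eS addrK.
have [//|m n nm|d d0|l lu] := @complete_modulus _ _ _ u e.
- by rewrite (le_trans (u_cauchy _ _ nm))// lerBlDr lerDl.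
- have [|n nd] := @invSn_small _ _ (d / 2); first by rewrite divr_gt0.
  exists n; apply: le_lt_trans (_ : 2 * c n < d).
    rewrite mulr_natl mulr2n lerD2l ler_pdivrMr// ler_peMr// ?ler1n//.
    exact: ltW.
  rewrite mulrC -ltr_pdivlMr// (le_lt_trans _ nd)//.
  by rewrite lef_pV2 ?posrE ?exprn_gt0// -natrX ler_nat ltn_expl.
have [C wC] := Wy l.
have [|n Cn] := @scalar_archimedean _ _ C.
  exact: le_trans (normr_ge0 _) (wC _ (wP 0%N).1).
have en : e n.+1 = c n / 2.
  by move: (eS n); rewrite {1}/e => /addrI.
have : c n * `|w n| <= n%:R + c n * `|w n| / 2.
  rewrite (le_trans (wu n))// -[u n.+1](subKr l) innerBr.
  rewrite (le_trans (ler_normB _ _))// lerD//.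
    by rewrite (le_trans (wC _ (wP n).1))// ltW.
  rewrite (le_trans (cauchy_schwarz _ _))// mulrC mulrAC ler_wpM2r//.
  by rewrite -en lu.
rewrite [leLHS]splitr lerD2r ler_pdivrMr// mulrC ler_pdivrMr ?exprn_gt0//.
by rewrite lt_geF ?(wP n).2.
Qed.

End Invertibility.

(** * Moore-Penrose inverses *)

Section MoorePenrose.
Variables (R : realType) (k : scalar_kind).
Local Notation K := (scalar_field R k).
Implicit Types H L : hilbertType R k.

Lemma orthogonal_projection H (M : set H) : closed M -> is_subspace M ->
  exists P : 'B(H, H), [/\ forall x, M (P x), forall x, M x -> P x = x &
    forall x v, M v -> '[P x, v] = '[x, v]].
Proof.
move=> clM sM.
have /choice[f fP] : forall x, exists m, M m /\ forall v, M v -> '[m, v] = '[x, v].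
  move=> x; have [m Mm xm] := orthogonal_decomposition x clM sM.
  by exists m; split=> // v /xm; rewrite innerBl => /subr0_eq.
have f_unique x m : M m -> (forall v, M v -> '[m, v] = '[x, v]) -> f x = m.
  move=> Mm mx; apply/eqP; rewrite -subr_eq0 -normr_eq0 -sqrf_eq0 -inner_norm.
  have Mv := subspaceB sM (fP x).1 Mm.
  by rewrite innerBl (fP x).2// mx// subrr.
have [||P PE] := @bounded_operator_of _ _ _ _ f.
- move=> a x y; apply: f_unique; first exact: sM.2 (fP x).1 (fP y).1.
  by move=> v Mv; rewrite !innerDl !innerZl (fP x).2// (fP y).2.
- exists 1 => // x; rewrite mul1r.
  have [->|fx0] := eqVneq (f x) 0; first by rewrite normr0.
  have nfx0 : 0 < `|f x| by rewrite normr_gt0.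
  rewrite -(ler_pM2r nfx0) -expr2 -[leLHS]ger0_norm ?exprn_ge0//.
  by rewrite -inner_norm ((fP x).2 _ (fP x).1) cauchy_schwarz.
exists P; split=> [x|x Mx|x v Mv]; rewrite PE; first exact: (fP x).1.
  exact: f_unique.
exact: (fP x).2.
Qed.

(** The set of all [w] in [range A] with [|adj A w| <= 1] is weakly bounded: if
    [A x] is the projection of [y], then
    ['[w, y] = '[w, A x] = '[adj A w, x]]. *)
Lemma adjoint_bounded_below H L (A : 'B(H, L)) : closed (range A) ->
  exists2 C : K, 0 <= C & forall w, range A w -> `|w| <= C * `|adj A w|.
Proof.
move=> clA; have sA := range_subspace A.
have [|C C0 WC] := @weakly_bounded _ _ _ [set w | range A w /\ `|adj A w| <= 1].
  move=> y; have [_ [x _ <-] yx] := orthogonal_decomposition y clA sA.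
  exists `|x| => w [Aw Aw1]; have := inner_eq0C (yx _ Aw).
  rewrite innerBr => /subr0_eq ->; rewrite -adjPl.
  by rewrite (le_trans (cauchy_schwarz _ _))// ler_piMl.
exists C => // w Aw; have [Aw0|Aw0] := eqVneq (adj A w) 0.
  suff -> : w = 0 by rewrite normr0 mulr_ge0.
  case: Aw Aw0 => x _ <- AAx; apply/eqP.
  by rewrite -normr_eq0 -sqrf_eq0 -inner_norm adjP AAx inner0r.
have nAw0 : 0 < `|adj A w| by rewrite normr_gt0.
have := WC (`|adj A w|^-1 *: w + 0).
rewrite addr0 normrZ normfV normr_id mulrC ler_pdivrMr//; apply; split.
  by rewrite -[_ *: w]addr0; exact: sA.2 Aw sA.1.
by rewrite linearZ /= normrZ normfV normr_id mulVf ?gt_eqF.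
Qed.

(** With [P] the projection onto [range A], the operator [A ** adj A + (id_op - P)] is
    coercive and commutes with [P]; if [G] is its inverse, [adj A ** G] is the
    Moore-Penrose inverse. *)
Lemma mpinv_exists H L (A : 'B(H, L)) : closed (range A) -> exists Z, is_mpinv A Z.
Proof.
move=> clA; have sA := range_subspace A.
have [P [PA Pfix Porth]] := orthogonal_projection clA sA.
have PAE : P ** A = A.
  by apply: bounded_operator_eq => x; apply: Pfix; exists x.
have adjPE : adj P = P.
  apply: adj_unique => x y; rewrite -(Porth x _ (PA y)) innerC -(Porth y _ (PA x)).
  exact/esym/innerC.
have [C C0 AC] := adjoint_bounded_below clA.
have adjAP : adj A ** P = adj A by rewrite -{1}adjPE -adj_comp PAE.
have PP : P ** P = P by apply: bounded_operator_eq => x; apply: Pfix.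
pose T := A ** adj A + (id_op - P).
have adjT : adj T = T.
  by rewrite /T adjD adj_comp adjK adjB adj_id adjPE.
have TP : T ** P = A ** adj A.
  by rewrite comp_opDl -comp_opA adjAP comp_opBl comp_idop PP subrr addr0.
have PT : P ** T = A ** adj A.
  by rewrite comp_opDr comp_opA PAE comp_opBr comp_opid PP subrr addr0.
(* [|x|^2] is the sum of [|P x|^2], at most [C^2 |adj A x|^2], and [|x - P x|^2]. *)
have T_coercive x : `|x| ^+ 2 <= (C ^+ 2 + 1) * `|'[T x, x]|.
  have xPx : '[x - P x, P x] = 0 by rewrite innerBl (Porth _ _ (PA x)) subrr.
  have -> : '[T x, x] = `|adj A x| ^+ 2 + `|x - P x| ^+ 2.
    rewrite -!inner_norm [in RHS]innerBr xPx subr0.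
    have -> : T x = A (adj A x) + (x - P x) by [].
    by rewrite innerDl adjP.
  rewrite ger0_norm ?addr_ge0 ?exprn_ge0// -[in leLHS](subrK (P x) x).
  rewrite pythagoras// [leLHS]addrC mulrDr lerD//.
    rewrite mulrDl mul1r ler_wpDr ?exprn_ge0// -exprMn ler_pXn2r ?nnegrE ?mulr_ge0//.
    by rewrite -adjAP AC.
  by rewrite mulrDl mul1r ler_wpDl// mulr_ge0// exprn_ge0.
have [|G [TG GT]] := coercive_invertible _ T_coercive.
  by rewrite addr_ge0// exprn_ge0.
have PG : P ** G = G ** P.
  rewrite -[P in LHS]comp_idop -GT -!comp_opA.
  by rewrite (comp_opA T) TP -PT -!comp_opA TG comp_opid.
have adjG : adj G = G.
  by rewrite -[adj G]comp_opid -TG comp_opA -{1}adjT -adj_comp TG adj_id comp_idop.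
have AZ : A ** (adj A ** G) = P by rewrite comp_opA -PT -comp_opA TG comp_opid.
exists (adj A ** G); split.
- by rewrite AZ PAE.
- by rewrite -comp_opA AZ -comp_opA -PG comp_opA adjAP.
- by rewrite AZ.
- by rewrite !adj_comp adjG adjK comp_opA.
Qed.

Lemma mpinv_unique H L (A : 'B(H, L)) Y Z : is_mpinv A Y -> is_mpinv A Z -> Y = Z.
Proof.
move=> [AYA YAY AYs YAs] [AZA ZAZ AZs ZAs].
have AYZ : A ** Y = A ** Z.
  rewrite -AYs -{1}AZA -comp_opA adj_comp AYs AZs.
  by rewrite comp_opA AYA.
have YAZ : Y ** A = Z ** A.
  rewrite -YAs -{1}AZA -comp_opA comp_opA adj_comp ZAs YAs.
  by rewrite -comp_opA (comp_opA A) AYA.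
by rewrite -YAY -comp_opA AYZ comp_opA YAZ ZAZ.
Qed.

Lemma mpinvP H L (A : 'B(H, L)) : closed (range A) -> is_mpinv A (mpinv A).
Proof.
move=> /mpinv_exists[Z AZ].
exact: (@xgetPex _ 0 [set Z | is_mpinv A Z] (ex_intro _ Z AZ)).
Qed.

Lemma mpinvE H L (A : 'B(H, L)) Z : is_mpinv A Z -> mpinv A = Z.
Proof.
move=> AZ; apply: (mpinv_unique _ AZ).
exact: (@xgetPex _ 0 [set Z | is_mpinv A Z] (ex_intro _ Z AZ)).
Qed.

(** The range of [A] is the kernel of the bounded operator [id_op - A ** Z]. *)
Lemma closed_range_of_inner_inverse H L (A : 'B(H, L)) (Z : 'B(L, H)) :
  A ** Z ** A = A -> closed (range A).
Proof.
move=> AZA; apply/closed_approxP => y yA.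
suff yE : y - A (Z y) = 0 by exists (Z y) => //; apply/esym/subr0_eq.
pose Q : 'B(L, L) := id_op - A ** Z.
have QA : Q ** A = 0 by rewrite comp_opBl comp_idop AZA subrr.
have [C C0 QC] := operator_bounded Q.
apply/eqP; rewrite -normr_eq0; apply/eqP.
apply: (eq0_le_invSn C0) => n; rewrite normr_id.
have [|_ [x _ <-] yx] := yA n.+1%:R^-1; first by rewrite invr_gt0.
have -> : y - A (Z y) = Q (y - A x).
  by rewrite operatorB -[Q (A x)]comp_opE QA subr0.
by rewrite (le_trans (QC _))// ler_wpM2l.
Qed.

Lemma inv_op_id H : inv_op (id_op : 'B(H, H)) = id_op.
Proof.
have idI : is_inv (id_op : 'B(H, H)) id_op by split; rewrite comp_idop.
have [+ _] := @xgetPex _ 0 [set Z | is_inv (id_op : 'B(H, H)) Z]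
  (ex_intro _ _ idI).
by rewrite comp_idop.
Qed.

End MoorePenrose.

(** * The Moore-Penrose inverse of a perturbed operator *)

Theorem theorem4p1 (R : realType) (k : scalar_kind)
    (H1 H2 H3 : hilbertType R k)
    (A : 'B(H1, H2)) (U : 'B(H3, H2)) (V : 'B(H3, H1)) :
  closed (range A) ->
  let SA : 'B(H3, H3) := id_op + adj V ** mpinv A ** U in
  closed (range SA) ->
  let E := id_op - SA ** mpinv SA in
  let F := id_op - mpinv SA ** SA in
  range U `<=` range A ->
  range V `<=` range (adj A) ->
  range (adj U) `<=` range SA ->
  range (adj V) `<=` range (adj SA) ->
  closed (range (A + U ** adj V)) /\
  mpinv (A + U ** adj V) =
    inv_op (id_op + mpinv A ** U ** F ** adj U ** adj (mpinv A))
    ** (mpinv A - mpinv A ** U ** mpinv SA ** adj V ** mpinv A)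
    ** inv_op (id_op + adj (mpinv A) ** V ** E ** adj V ** mpinv A).
Proof.
move=> clA S clS E F UA VA US VS.
have := mpinvP clA; have := mpinvP clS; rewrite /E /F {E F}.
set B := mpinv A in S clS US VS *; set G := mpinv S.
move=> [SGS _ SGs GSs] [ABA BAB ABs BAs].
have BAA : B ** A ** adj A = adj A by rewrite -BAs -adj_comp comp_opA ABA.
have GSS : G ** S ** adj S = adj S by rewrite -GSs -adj_comp comp_opA SGS.
have ABU : A ** B ** U = U := range_sub_fixed ABA UA.
have BAV : B ** A ** V = V := range_sub_fixed BAA VA.
have SGU : S ** G ** adj U = adj U := range_sub_fixed SGS US.
have GSV : G ** S ** adj V = adj V := range_sub_fixed GSS VS.
have VBA : adj V ** (B ** A) = adj V by rewrite -{1}BAs -adj_comp BAV.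
have USG : U ** (S ** G) = U by rewrite -[U]adjK -SGs -adj_comp SGU.
(* [S E = E] puts the range of [E] inside that of [S], which [E] annihilates. *)
have SG : S ** G = id_op.
  pose E : 'B(H3, H3) := id_op - S ** G.
  have UE : U ** E = 0 by rewrite comp_opBr comp_opid USG subrr.
  have SE : S ** E = E by rewrite comp_opDl comp_idop -comp_opA UE comp_op0 addr0.
  apply/eqP; rewrite eq_sym -subr_eq0 -/E -SE.
  rewrite -{1}SGS -[S ** G ** S ** E]comp_opA SE.
  by rewrite comp_opBr comp_opid !comp_opA SGS subrr.
(* Dually, [F = F S = F S G S = F (G S)], and [F] annihilates [G S]. *)
have GS : G ** S = id_op.
  pose F : 'B(H3, H3) := id_op - G ** S.
  have FV : F ** adj V = 0 by rewrite comp_opBl comp_idop GSV subrr.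
  have FS : F ** S = F.
    by rewrite comp_opDr comp_opid !comp_opA FV !comp_0op addr0.
  apply/eqP; rewrite eq_sym -subr_eq0 -/F -FS.
  rewrite -{1}SGS -[S ** G ** S]comp_opA comp_opA FS.
  by rewrite comp_opBl comp_idop -!comp_opA (comp_opA S) SGS subrr.
rewrite SG GS subrr !(comp_op0, comp_0op) addr0 inv_op_id comp_idop.
rewrite addr0 inv_op_id comp_opid.
have VBU : adj V ** B ** U = S - id_op by rewrite /S [RHS]addrC addKr.
pose N := B - B ** U ** G ** adj V ** B.
(* Both products telescope once [adj V ** B ** U] is written [S - id_op]. *)
have MN : (A + U ** adj V) ** N = A ** B.
  have -> : (A + U ** adj V) ** N =
      A ** B - U ** G ** adj V ** B +
      (U ** adj V ** B - U ** (adj V ** B ** U) ** G ** adj V ** B).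
    by rewrite /N comp_opDl !comp_opBr !comp_opA ABU.
  rewrite VBU comp_opBr comp_opid !comp_opBl -(comp_opA U S) SG comp_opid.
  by rewrite subKr subrK.
have NM : N ** (A + U ** adj V) = B ** A.
  have -> : N ** (A + U ** adj V) =
      B ** A - B ** U ** G ** (adj V ** (B ** A)) +
      (B ** U ** adj V - B ** U ** G ** (adj V ** B ** U) ** adj V).
    by rewrite /N comp_opDr !comp_opBl !comp_opA.
  rewrite VBA VBU comp_opBr comp_opid !comp_opBl -(comp_opA (B ** U) G S) GS.
  by rewrite comp_opid subKr subrK.
have MNM : (A + U ** adj V) ** N ** (A + U ** adj V) = A + U ** adj V.
  by rewrite MN comp_opDr comp_opA ABA ABU.
split; first exact: closed_range_of_inner_inverse MNM.
apply: mpinvE; split=> //.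
- by rewrite NM /N comp_opBr !comp_opA BAB.
- by rewrite MN.
- by rewrite NM.
Qed.
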